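(* Let $n\ge1$ and $I\subset[n-1]$, written as a disjoint union of maximal intervals $I=\bigcup_{1\le t\le k}\{u_t,u_t+1,\ldots,v_t\}$ with $u_t\le v_t$ and $v_t+1\le u_{t+1}-1$. For $A,B\in\mathrm{ASM}^I(n)$, the join of $A$ and $B$ in $\mathrm{ASM}^I(n)$ agrees with their join in $\mathrm{ASM}(n)$, while the meet of $A$ and $B$ in $\mathrm{ASM}^I(n)$, denoted by $C$, is given by: for all $j\in[n]$, \[r_C(i,j)=\begin{cases}\max\{r_A(i,j),r_B(i,j)\}, & i\in[n]\setminus I,\\ \min\{r_C(v_t+1,j),\ r_C(u_t-1,j)+(i-u_t+1)\}, & u_t\le i\le v_t,\ t\in[k].\end{cases}\]
   Context: $[m]=\{1,\dots,m\}$. An alternating sign matrix (ASM) is a square matrix with entries in $\{0,1,-1\}$ such that the nonzero entries in each row and each column alternate in sign and each row and each column sums to $1$; $\mathrm{ASM}(n)$ is the set of $n\times n$ ASMs. The rank matrix of $A$ is $r_A(i,j)=\sum_{p=1}^i\sum_{q=1}^jA_{p,q}$, with $r_A(0,j)=r_A(i,0)=0$; it determines $A$. Order on $\mathrm{ASM}(n)$: $A\le B$ iff $r_A(i,j)\ge r_B(i,j)$ for all $i,j\in[n]$; this makes $\mathrm{ASM}(n)$ a lattice, with join (resp. meet) given by entrywise minimum (resp. maximum) of rank matrices. $\mathrm{ASM}^I(n):=\{A\in\mathrm{ASM}(n)\mid r_A(i,j)\in\{r_A(i-1,j)+1,\ r_A(i+1,j)\}\text{ for all }i\in I,\ j\in[n]\}$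 with the induced order. *)

(* Defs.v *)
From HB Require Import structures.
From mathcomp Require Import all_boot all_order all_algebra.
From mathcomp Require Import classical_sets.
Set Implicit Arguments.
Unset Strict Implicit.
Unset Printing Implicit Defensive.
Import Order.TTheory GRing.Theory Num.Theory.
Local Open Scope ring_scope.

(* Rows and columns of a matrix are indexed by 'I_n, that is by 0, ..., n-1,
   whereas the arguments of [rank] are 1-based: [rank A i j] sums the first i
   rows and the first j columns. Hence i, j in [n] is rendered either by natural
   numbers 1 <= i, j <= n, or by i.+1, j.+1 with i, j : 'I_n. *)

Definition alternating (s : seq int) : bool :=
  sorted (fun x y => x * y < 0) [seq x <- s | x != 0].

Definition is_asm n (A : 'M[int]_n) : bool :=
  [&& [forall i, forall j, A i j \in [:: 0; 1; -1]],
      [forall i, alternating [seq A i j | j : 'I_n]],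
      [forall j, alternating [seq A i j | i : 'I_n]],
      [forall i, \sum_j A i j == 1]
    & [forall j, \sum_i A i j == 1]].

Definition rank n (A : 'M[int]_n) (i j : nat) : int :=
  \sum_(p < n | (p < i)%N) \sum_(q < n | (q < j)%N) A p q.

Record asm n := Asm { asm_val :> 'M[int]_n; _ : is_asm asm_val }.
HB.instance Definition _ n := [isSub for @asm_val n].
HB.instance Definition _ n := [Choice of asm n by <:].

Definition asm_le n (A B : asm n) : bool :=
  [forall i : 'I_n, forall j : 'I_n, rank B i.+1 j.+1 <= rank A i.+1 j.+1].

Lemma asm_le_refl n : reflexive (@asm_le n).
Proof. by move=> A; apply/forallP=> i; apply/forallP=> j. Qed.

Lemma asm_le_trans n : transitive (@asm_le n).
Proof.
move=> B A C /forallP AB /forallP BC; apply/forallP=> i; apply/forallP=> j.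
exact: le_trans (forallP (BC i) j) (forallP (AB i) j).
Qed.

Lemma rank0l n (A : 'M[int]_n) j : rank A 0 j = 0.
Proof. by rewrite /rank big_pred0. Qed.

Lemma rank0r n (A : 'M[int]_n) i : rank A i 0 = 0.
Proof. by rewrite /rank big1 // => p _; rewrite big_pred0. Qed.

Lemma rank_rowS n (A : 'M[int]_n) (i : 'I_n) j :
  rank A i.+1 j = rank A i j + \sum_(q < n | (q < j)%N) A i q.
Proof.
rewrite /rank (bigD1 i) //= addrC; congr (_ + _); apply: eq_bigl => p.
by rewrite ltnS andbC -val_eqE /= ltn_neqAle.
Qed.

Lemma rank_entry n (A : 'M[int]_n) (i j : 'I_n) :
  A i j = rank A i.+1 j.+1 - rank A i j.+1 - (rank A i.+1 j - rank A i j).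
Proof.
rewrite !rank_rowS [rank A i j.+1 + _]addrC [rank A i j + _]addrC !addrK.
apply/eqP; rewrite eq_sym subr_eq; apply/eqP.
rewrite (bigD1 j) //=; congr (_ + _); apply: eq_bigl => q.
by rewrite ltnS andbC -val_eqE /= ltn_neqAle.
Qed.

Lemma asm_le_anti n : antisymmetric (@asm_le n).
Proof.
move=> A B /andP[/forallP AB /forallP BA]; apply: val_inj.
have E i j : (i <= n)%N -> (j <= n)%N -> rank A i j = rank B i j.
  case: i => [|i] hi; first by rewrite !rank0l.
  case: j => [|j] hj; first by rewrite !rank0r.
  apply/eqP; rewrite eq_le (forallP (AB (Ordinal hi)) (Ordinal hj)).
  by rewrite (forallP (BA (Ordinal hi)) (Ordinal hj)).
by apply/matrixP => i j; rewrite !rank_entry !E // ltnW.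
Qed.

Fact asm_display : Order.disp_t. Proof. exact: Order.Disp tt tt. Qed.

HB.instance Definition _ n :=
  Order.Le_isPOrder.Build asm_display (asm n)
    (@asm_le_refl n) (@asm_le_anti n) (@asm_le_trans n).

Definition is_asmI n (I : {pred nat}) (A : asm n) : bool :=
  [forall i : 'I_n, forall j : 'I_n, (i.+1 \in I) ==>
    (rank A i.+1 j.+1 \in [:: rank A i j.+1 + 1; rank A i.+2 j.+1])].

Record asmI n (I : {pred nat}) :=
  AsmI { asmI_val :> asm n; _ : is_asmI I asmI_val }.
HB.instance Definition _ n I := [isSub for @asmI_val n I].
HB.instance Definition _ n I := [Choice of asmI n I by <:].
HB.instance Definition _ n I :=
  [SubChoice_isSubPOrder of asmI n I by <: with asm_display].

(* Main.v *)
(* Rank matrices of ASMs are the functions on [0, n]^2 with the right boundary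
   values whose steps in both directions are 0 or 1. Entrywise minimum preserves
   this and the condition defining ASM^I, whence the join. On a column, a member
   of ASM^I is determined by its values at the rows h outside I, through
   r(i) = min_h (r(h) + (i - h)^+). Applying this formula to
   max(r_A, r_B) yields the meet: steps remain in {0, 1}, a minimizer h < i
   (resp. h > i) forces r(i) = r(i-1) + 1 (resp. r(i) = r(i+1)), and every lower
   bound of A and B in ASM^I satisfies the same formula. *)
Require Import Defs.
From mathcomp Require Import all_boot all_order all_algebra.
From mathcomp Require Import classical_sets zify.
Import Order.TTheory GRing.Theory Num.Theory.
Local Open Scope classical_set_scope.
Local Open Scope ring_scope.

(** * Alternating sequences through their running sums *)

(* A running sum with values in {0, 1} determines the last nonzero summand: it
   is 1 if the sum is 1 and -1 if the sum is 0. *)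
Lemma alternating_from_sumsP (s : seq int) (c : int) : c \in [:: 0; 1] ->
  all (mem [:: 0; 1; -1]) s
    && path (fun x y => x * y < 0) (c *+ 2 - 1) [seq x <- s | x != 0]
  <-> forall m, 0 <= c + \sum_(x <- take m s) x <= 1.
Proof.
elim: s c => [|x s IHs] c hc.
  by split=> // _ m; rewrite big_nil; move: hc; rewrite !inE; lia.
have sums_cons m : \sum_(y <- take m.+1 (x :: s)) y = x + \sum_(y <- take m s) y.
  by rewrite /= big_cons.
have -> : (forall m, 0 <= c + \sum_(y <- take m (x :: s)) y <= 1) <->
    c + x \in [:: 0; 1] /\ forall m, 0 <= c + x + \sum_(y <- take m s) y <= 1.
  split=> [h|[_ h] [|m]].
  - split=> [|m]; last by have := h m.+1; rewrite sums_cons addrA.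
    by have := h 1%N; rewrite sums_cons take0 big_nil !inE; lia.
  - by rewrite big_nil; move: hc; rewrite !inE; lia.
  - by rewrite sums_cons addrA.
have [cx|cx] := boolP (c + x \in [:: 0; 1]); last first.
  split=> [|[]//]; rewrite /= !inE => /andP[/andP[hx _]].
  by have [x0|x0] /= := eqVneq x 0; move: hc hx cx; rewrite !inE; nia.
have hx : x \in [:: 0; 1; -1] by move: hc cx; rewrite !inE; lia.
have := IHs _ cx; rewrite /= inE -!in_cons hx /=.
have [->|x0] /= := eqVneq x 0; first by rewrite addr0 => -[H1 H2]; split=> [/H1|[_ /H2]].
have -> : (c + x) *+ 2 - 1 = x by move: hc cx hx; rewrite !inE; lia.
have -> : (c *+ 2 - 1) * x < 0 by move: hc cx hx; rewrite !inE; nia.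
by move=> -[H1 H2]; split=> [/H1|[_ /H2]].
Qed.

(** The start value 0 amounts to a virtual entry -1 before [s], which forces the first nonzero entry
    to be 1; for an alternating sequence this has to come from the total being 1. *)
Lemma alternating_sumsP (s : seq int) : \sum_(x <- s) x = 1 ->
  all (mem [:: 0; 1; -1]) s && alternating s
  <-> forall m, 0 <= \sum_(x <- take m s) x <= 1.
Proof.
move=> s1; have [//|from0 to0] := alternating_from_sumsP s 0.
split=> [|h]; last first.
  have /andP[-> /path_sorted hs] := to0 (fun m => ltac:(by rewrite add0r)).
  by rewrite /alternating hs.
case/andP=> hs alt m; rewrite -[X in 0 <= X]add0r -[X in X <= 1]add0r.
apply: from0; rewrite hs /=; move: alt; rewrite /alternating.
case E: [seq x <- s | x != 0] => [//|y t] /= ht; rewrite ht andbT.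
have : y \in [seq x <- s | x != 0] by rewrite E mem_head.
rewrite mem_filter => /andP[y0 /(allP hs)]; rewrite !inE => hy.
have [y1|y1] : y = 1 \/ y = -1 by lia.
  by rewrite y1.
(* If the first nonzero entry is -1, the sums started at 1 stay at most 1, but the last of them is 1
   + 1. *)
have [//|from1 _] := alternating_from_sumsP s 1.
have := from1; rewrite hs E /= ht y1 /= => /(_ isT (size s)).
by rewrite take_size s1.
Qed.

(** * Partial sums along rows and columns *)

Lemma take_enum_ord n m : take m (enum 'I_n) = [seq q : 'I_n <- enum 'I_n | (q < m)%N].
Proof.
apply: (inj_map val_inj); rewrite map_take val_enum_ord take_iota.
transitivity [seq q <- map val (enum 'I_n) | (q < m)%N]; last by rewrite filter_map.
rewrite val_enum_ord.
have [mn|/ltnW nm] := leqP m n; first exact: esym (filter_iota_ltn 0 mn).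
rewrite -[LHS]filter_predT; apply: eq_in_filter => q.
by rewrite mem_iota => /andP[_ /leq_trans->].
Qed.

Definition prefix_sum {n} (f : 'I_n -> int) (m : nat) : int :=
  \sum_(q < n | (q < m)%N) f q.

Lemma prefix_sumS n (f : 'I_n -> int) (i : 'I_n) :
  prefix_sum f i.+1 = prefix_sum f i + f i.
Proof.
rewrite /prefix_sum (bigD1 i) //= addrC; congr (_ + _); apply: eq_bigl => p.
by rewrite ltnS andbC -val_eqE /= ltn_neqAle.
Qed.

Lemma prefix_sum_full n (f : 'I_n -> int) : prefix_sum f n = \sum_q f q.
Proof. by apply: eq_bigl => q; rewrite ltn_ord. Qed.

Lemma sum_take_ord n (f : 'I_n -> int) m :
  \sum_(x <- take m [seq f j | j : 'I_n]) x = prefix_sum f m.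
Proof. by rewrite -map_take big_map take_enum_ord big_filter big_enum_cond. Qed.

Lemma sum_image_ord n (f : 'I_n -> int) :
  \sum_(x <- [seq f j | j : 'I_n]) x = \sum_j f j.
Proof. by rewrite big_map big_enum. Qed.

Lemma is_asmP n (A : 'M[int]_n) :
  is_asm A <->
  (forall i, prefix_sum (A i) n = 1 /\ forall m, 0 <= prefix_sum (A i) m <= 1) /\
  (forall j, prefix_sum (A ^~ j) n = 1 /\
     forall m, 0 <= prefix_sum (A ^~ j) m <= 1).
Proof.
have line (f : 'I_n -> int) : \sum_q f q = 1 ->
    (forall q, f q \in [:: 0; 1; -1]) /\ alternating [seq f q | q : 'I_n]
    <-> forall m, 0 <= prefix_sum f m <= 1.
  rewrite -sum_image_ord => /alternating_sumsP E; split=> [[hf alt] m|h].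
    rewrite -sum_take_ord; apply: (proj1 E); rewrite alt andbT.
    by apply/allP => _ /mapP[q _ ->]; apply: hf.
  have /E/andP[/allP hf alt] : forall m,
      0 <= \sum_(x <- take m [seq f j | j : 'I_n]) x <= 1.
    by move=> m; rewrite sum_take_ord.
  by split=> // q; apply/hf/map_f; rewrite mem_enum.
split.
  case/and5P=> /'forall_forallP entry /forallP row /forallP col.
  move=> /'forall_eqP row1 /'forall_eqP col1.
  by split=> i; rewrite prefix_sum_full; split=> //; apply/line.
case=> row col; apply/and5P; split; last 2 first.
- by apply/'forall_eqP => i; have [<- _] := row i; rewrite prefix_sum_full.
- by apply/'forall_eqP => i; have [<- _] := col i; rewrite prefix_sum_full.
- apply/'forall_forallP => i; have [+ /line h] := row i.
  by rewrite prefix_sum_full => /h[].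
- apply/forallP => i; have [+ /line h] := row i.
  by rewrite prefix_sum_full => /h[].
- apply/forallP => i; have [+ /line h] := col i.
  by rewrite prefix_sum_full => /h[].
Qed.

(** * Rank matrices as corner sum functions *)

Definition half_corner_sum (n : nat) (r : nat -> nat -> int) : Prop :=
  [/\ forall i, (i <= n)%N -> r i 0 = 0,
      forall i, (i <= n)%N -> r i n = i
    & forall i j, (i < n)%N -> (j <= n)%N -> r i j <= r i.+1 j <= r i j + 1].

Definition corner_sum (n : nat) (r : nat -> nat -> int) : Prop :=
  half_corner_sum n r /\ half_corner_sum n (fun i j => r j i).

Lemma rank_tr n (A : 'M[int]_n) i j : rank A^T i j = rank A j i.
Proof.
rewrite /rank exchange_big; apply: eq_bigr => p _.
by apply: eq_bigr => q _; rewrite mxE.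
Qed.

Lemma rank_half_corner_sum n (A : 'M[int]_n) :
  (forall i, prefix_sum (A i) n = 1 /\ forall m, 0 <= prefix_sum (A i) m <= 1) ->
  half_corner_sum n (rank A).
Proof.
move=> row; split=> [i _|i|i j hi _]; first exact: rank0r.
  elim: i => [|i IHi] hi; first by rewrite rank0l.
  rewrite (rank_rowS A (Ordinal hi)) IHi 1?ltnW // intS addrC.
  by have [<- _] := row (Ordinal hi).
rewrite (rank_rowS A (Ordinal hi)) /=.
by have [_ /(_ j)] := row (Ordinal hi); rewrite lerDl lerD2l.
Qed.

Lemma rank_corner_sum n (A : asm n) : corner_sum n (rank A).
Proof.
case: A => A /= /is_asmP[row col]; split; first exact: rank_half_corner_sum.
have [] : half_corner_sum n (rank A^T).
  apply: rank_half_corner_sum => i.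
  have tr m : prefix_sum (A^T i) m = prefix_sum (A ^~ i) m.
    by apply: eq_bigr => q _; rewrite mxE.
  by have [col1 col01] := col i; split=> [|m]; rewrite tr.
move=> c0 cn cstep; split=> [j /c0|j /cn|j i hj hi]; rewrite -!(rank_tr _ A) //.
exact: cstep.
Qed.

(** Mixed second differences invert [rank]: prefix sums of their rows and columns telescope to
    single steps of [r], which are 0 or 1. *)
Lemma asm_of_corner_sum n (r : nat -> nat -> int) : corner_sum n r ->
  exists A : asm n, forall i j, (i <= n)%N -> (j <= n)%N -> rank A i j = r i j.
Proof.
case=> [[ri0 rin rstep] [r0j rnj cstep]].
pose A : 'M[int]_n :=
  \matrix_(i, j) (r i.+1 j.+1 - r i j.+1 - (r i.+1 j - r i j)).
have row (i : 'I_n) m : (m <= n)%N -> prefix_sum (A i) m = r i.+1 m - r i m.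
  elim: m => [|m IHm] hm.
    by rewrite /prefix_sum big_pred0 // !ri0 ?(ltnW (ltn_ord i)) //.
  by rewrite (prefix_sumS _ _ (Ordinal hm)) IHm ?mxE 1?ltnW //=; lia.
have col (j : 'I_n) m : (m <= n)%N -> prefix_sum (A ^~ j) m = r m j.+1 - r m j.
  elim: m => [|m IHm] hm.
    by rewrite /prefix_sum big_pred0 // !r0j ?(ltnW (ltn_ord j)) //.
  by rewrite (prefix_sumS _ _ (Ordinal hm)) IHm ?mxE 1?ltnW //=; lia.
(* [is_asmP] bounds prefix sums of every length, while [r] is controlled only up to [n]. *)
have trunc (f : 'I_n -> int) m : prefix_sum f m = prefix_sum f (minn m n).
  by apply: eq_bigl => q; have := ltn_ord q; lia.
have asmA : is_asm A.
  apply/is_asmP; split=> i; have hi := ltn_ord i.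
    split=> [|m]; first by rewrite row // !rin //; lia.
    rewrite trunc row ?geq_minr //.
    by have := rstep i (minn m n) hi (geq_minr _ _); lia.
  split=> [|m]; first by rewrite col // !rnj //; lia.
  rewrite trunc col ?geq_minr //.
  by have := cstep i (minn m n) hi (geq_minr _ _); lia.
exists (Asm asmA) => i j hi hj /=; elim: i hi => [|i IHi] hi.
  by rewrite rank0l r0j.
rewrite (rank_rowS A (Ordinal hi)) IHi 1?ltnW // -/(prefix_sum (A (Ordinal hi)) j).
by rewrite row //=; lia.
Qed.

(** * The order and the row condition in terms of ranks *)

Lemma asm_leP n (A B : asm n) :
  reflect (forall i j, (i <= n)%N -> (j <= n)%N -> rank B i j <= rank A i j)
          (A <= B)%O.
Proof.
apply: (iffP 'forall_forallP) => [AB [|i] [|j] hi hj | AB i j].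
- by rewrite !rank0l.
- by rewrite !rank0l.
- by rewrite !rank0r.
- exact: (AB (Ordinal hi) (Ordinal hj)).
- exact: AB.
Qed.

Lemma asmI_leE n (I : {pred nat}) (A B : asmI n I) :
  (A <= B)%O = (asmI_val A <= asmI_val B)%O.
Proof. by []. Qed.

Lemma is_asmIP n (I : {pred nat}) (A : asm n) :
  (forall i, i \in I -> (1 <= i <= n - 1)%N) ->
  reflect (forall i j, i.+1 \in I -> (j <= n)%N ->
             rank A i.+1 j = rank A i j + 1 \/ rank A i.+1 j = rank A i.+2 j)
          (is_asmI I A).
Proof.
move=> hI; apply: (iffP 'forall_forallP) => [AI i [|j] iI hj | AI i j].
- by right; rewrite !rank0r.
- have hi : (i < n)%N by have := hI _ iI; lia.
  have := implyP (AI (Ordinal hi) (Ordinal hj)) iI.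
  by rewrite !inE => /orP[]/eqP; auto.
- by apply/implyP => iI; rewrite !inE; apply/orP; have [//|->|->] := AI i j.+1 iI; auto.
Qed.

Lemma asmI_rank n (I : {pred nat}) (D : asmI n I) :
  (forall i, i \in I -> (1 <= i <= n - 1)%N) ->
  forall i j, i.+1 \in I -> (j <= n)%N ->
    rank D i.+1 j = rank D i j + 1 \/ rank D i.+1 j = rank D i.+2 j.
Proof. by move=> hI; apply/is_asmIP => //; case: D. Qed.

(** Monotonicity gives the case [i <= h], where the truncated difference is 0; slope at most 1 gives
    [h < i]. *)
Lemma corner_sum_lipschitz n r h i j : corner_sum n r ->
  (h <= n)%N -> (i <= n)%N -> (j <= n)%N -> r i j <= r h j + (i - h)%N.
Proof.
case=> [[_ _ step] _] hh hi hj.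
have up a d : (a + d <= n)%N -> r a j <= r (a + d)%N j <= r a j + d.
  elim: d => [|d IHd] ad; first by rewrite addn0; lia.
  by have := step (a + d)%N j; rewrite addnS in ad *; lia.
have [ih|hi'] := leqP i h.
  by have := up i (h - i)%N; rewrite subnKC //; lia.
by have := up h (i - h)%N; rewrite subnKC ?(ltnW hi') //; lia.
Qed.

(* Within an interval of I, column j of r_D first grows with slope 1 and then is
   constant; h is the end of the interval on the side where i lies. *)
Lemma asmI_rank_base n (I : {pred nat}) (D : asmI n I) i j :
  (forall i, i \in I -> (1 <= i <= n - 1)%N) -> (i <= n)%N -> (j <= n)%N ->
  exists h, [/\ (h <= n)%N, h \notin I & rank D i j = rank D h j + (i - h)%N].
Proof.
move=> hI hi hj; have DI := asmI_rank _ _ D hI.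
(* An increase into a row rules out flatness after the preceding row, so slope 1 propagates
   downwards until a row leaves [I], at the latest row 0. *)
have down : forall i, i.+1 \in I -> rank D i.+1 j = rank D i j + 1 ->
    exists h, [/\ (h <= i)%N, h \notin I & rank D i.+1 j = rank D h j + (i.+1 - h)%N].
  elim=> [|a IHa] aI Da.
    by exists 0; split=> //; apply/negP => /hI.
  have [a1I|a1I] := boolP (a.+1 \in I); last by exists a.+1; split=> //; lia.
  have [|Da'|Da'] := DI a j a1I => //; last by lia.
  by have [h [ha h_notin Dh]] := IHa a1I Da'; exists h; split=> //; lia.
(* Likewise flatness propagates upwards; [d] bounds the distance to row [n], which is outside
   [I]. *)
have up : forall d i, (n - i <= d)%N -> i.+1 \in I -> rank D i.+1 j = rank D i.+2 j ->
    exists h, [/\ (i.+1 < h <= n)%N, h \notin I & rank D i.+1 j = rank D h j].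
  elim=> [|d IHd] a ad aI Da; first by have := hI _ aI; lia.
  have [a2I|a2I] := boolP (a.+2 \in I); last first.
    by exists a.+2; split=> //; have := hI _ aI; lia.
  have [|Da'|Da'] := DI a.+1 j a2I => //; first by lia.
  have [|h [ha h_notin Dh]] := IHd a.+1 _ a2I Da'; first lia.
  by exists h; split=> //; lia.
have [iI|iI] := boolP (i \in I); last by exists i; split=> //; lia.
case: i hi iI => [|i] hi iI; first by have := hI _ iI.
have [//|Di|Di] := DI i j iI.
  by have [h [ha h_notin Dh]] := down i iI Di; exists h; split=> //; lia.
by have [h [ha h_notin Dh]] := up _ i (leqnn _) iI Di; exists h; split=> //; lia.
Qed.

(** * Entrywise minimum and maximum, and envelopes *)

Lemma corner_sum_min n r s : corner_sum n r -> corner_sum n s ->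
  corner_sum n (fun i j => Num.min (r i j) (s i j)).
Proof.
move=> [[r1 r2 r3] [r4 r5 r6]] [[s1 s2 s3] [s4 s5 s6]].
split; split=> [i hi|i hi|i j hi hj].
- by rewrite r1 // s1.
- by rewrite r2 // s2 //; lia.
- by have := r3 i j hi hj; have := s3 i j hi hj; lia.
- by rewrite r4 // s4.
- by rewrite r5 // s5 //; lia.
- by have := r6 i j hi hj; have := s6 i j hi hj; lia.
Qed.

Lemma corner_sum_max n r s : corner_sum n r -> corner_sum n s ->
  corner_sum n (fun i j => Num.max (r i j) (s i j)).
Proof.
move=> [[r1 r2 r3] [r4 r5 r6]] [[s1 s2 s3] [s4 s5 s6]].
split; split=> [i hi|i hi|i j hi hj].
- by rewrite r1 // s1.
- by rewrite r2 // s2 //; lia.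
- by have := r3 i j hi hj; have := s3 i j hi hj; lia.
- by rewrite r4 // s4.
- by rewrite r5 // s5 //; lia.
- by have := r6 i j hi hj; have := s6 i j hi hj; lia.
Qed.

(* r(i, j) is the minimum over h in P of m(h, j) + (i - h)^+, where the positive
   part is the truncated subtraction. *)
Definition is_envelope n (P : {pred nat}) (m r : nat -> nat -> int) : Prop :=
  forall i j, (i <= n)%N -> (j <= n)%N ->
    (exists h, [/\ (h <= n)%N, h \in P & r i j = m h j + (i - h)%N])
    /\ (forall h, (h <= n)%N -> h \in P -> r i j <= m h j + (i - h)%N).

Lemma envelope_exists n (P : {pred nat}) m : 0 \in P -> exists r, is_envelope n P m r.
Proof.
move=> P0; pose g i j (h : 'I_n.+1) : int := m h j + (i - h)%N.
pose r i j := g i j [arg min_(h < ord0 | (h : nat) \in P) g i j h]%O.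
exists r => i j _ _; rewrite /r; case: arg_minP => //= h hP hmin.
split; first by exists h; rewrite -ltnS.
by move=> h'; rewrite -ltnS => hh' /(hmin (Ordinal hh')).
Qed.

(** A minimizer for one position competes at the adjacent one, where its term differs by 0 or 1;
    comparing both minimizers bounds the step. Rows 0 and [n] in [P] give the boundary values. *)
Lemma envelope_corner_sum n (P : {pred nat}) m r : 0 \in P -> n \in P ->
  corner_sum n m -> is_envelope n P m r -> corner_sum n r.
Proof.
move=> P0 Pn cm env; have [[mi0 min mstep] [m0j mnj mcstep]] := cm; split; split.
- move=> i hi; have [[h [hn _ ->]] /(_ n (leqnn n) Pn)] := env i 0 hi isT.
  by rewrite mi0 // mi0 //; lia.
- move=> i hi; have [[h [hn _ ->]] /(_ 0 isT P0)] := env i n hi (leqnn n).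
  by rewrite !min //; lia.
- move=> i j hi hj.
  have [[h [hn hP rih]] ri] := env i j (ltnW hi) hj.
  have [[h' [hn' hP' rih']] ri'] := env i.+1 j hi hj.
  by have := ri h' hn' hP'; have := ri' h hn hP; lia.
- move=> j hj; have [[h [hn _ ->]] /(_ 0 isT P0)] := env 0 j isT hj.
  have := corner_sum_lipschitz n m h 0 j cm hn isT hj; rewrite !m0j //; lia.
- move=> j hj; have [[h [hn _ ->]] /(_ n (leqnn n) Pn)] := env n j (leqnn n) hj.
  by have := corner_sum_lipschitz n m h n j cm hn (leqnn n) hj; rewrite !mnj //; lia.
- move=> j i hj hi.
  have [[h [hn hP rih]] ri] := env i j hi (ltnW hj).
  have [[h' [hn' hP' rih']] ri'] := env i j.+1 hi hj.
  have := ri h' hn' hP'; have := ri' h hn hP.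
  by have := mcstep j h hj hn; have := mcstep j h' hj hn'; lia.
Qed.

(** By the Lipschitz bound no row beats the competitor [h = i]. *)
Lemma envelope_eq n (P : {pred nat}) m r i j : corner_sum n m ->
  is_envelope n P m r -> (i <= n)%N -> (j <= n)%N -> i \in P -> r i j = m i j.
Proof.
move=> cm env hi hj iP; have [[h [hn _ rih]] /(_ i hi iP)] := env i j hi hj.
by have := corner_sum_lipschitz n m h i j cm hn hi hj; lia.
Qed.

(** * Join and meet *)

Lemma asmI_join n (I : {pred nat}) (A B : asmI n I) :
  (forall i, i \in I -> (1 <= i <= n - 1)%N) ->
  exists J : asmI n I, forall i j, (i <= n)%N -> (j <= n)%N ->
    rank J i j = Num.min (rank A i j) (rank B i j).
Proof.
move=> hI; have cA := rank_corner_sum n A; have cB := rank_corner_sum n B.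
have [J rJ] := asm_of_corner_sum _ _ (corner_sum_min _ _ _ cA cB).
suff JI : is_asmI I J by exists (AsmI JI).
apply/is_asmIP => // i j iI hj; have hi := hI _ iI.
(* Whichever of [A], [B] attains the minimum in row [i.+1] passes its alternative on: the minimum is
   at most its value in rows [i] and [i.+2], and the step bounds give equality. *)
have AI := asmI_rank _ _ A hI i j iI hj; have BI := asmI_rank _ _ B hI i j iI hj.
have [[_ _ sA] _] := cA; have [[_ _ sB] _] := cB.
have := sA i j; have := sA i.+1 j; have := sB i j; have := sB i.+1 j.
by rewrite !rJ //; lia.
Qed.

(** The entrywise maximum can violate the condition on rows of [I], so only its values outside [I]
    are kept. *)
Lemma asmI_meet n (I : {pred nat}) (A B : asmI n I) :
  (forall i, i \in I -> (1 <= i <= n - 1)%N) ->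
  exists C : asmI n I,
    is_envelope n [predC I] (fun i j => Num.max (rank A i j) (rank B i j)) (rank C).
Proof.
move=> hI.
have I0 : 0 \in [predC I] by apply/negP => /hI.
have In : n \in [predC I] by apply/negP => /hI; lia.
have cm := corner_sum_max _ _ _ (rank_corner_sum n A) (rank_corner_sum n B).
pose m i j := Num.max (rank A i j) (rank B i j).
have [r env] := envelope_exists n [predC I] m I0.
have [C rC] := asm_of_corner_sum _ _ (envelope_corner_sum _ _ _ _ I0 In cm env).
suff CI : is_asmI I C.
  exists (AsmI CI) => i j hi hj; rewrite /= rC //; exact: env.
apply/is_asmIP => // i j iI hj; have hi := hI _ iI.
have [|[h [hn hP rih]] _] := env i.+1 j _ hj; first lia.
have hne : h != i.+1 by apply: contraNneq hP => ->.
have [|_ /(_ h hn hP) ri] := env i j _ hj; first lia.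
have [|_ /(_ h hn hP) ri2] := env i.+2 j _ hj; first lia.
have [[_ _ step] _] := envelope_corner_sum _ _ _ _ I0 In cm env.
have := step i j; have := step i.+1 j.
by rewrite !rC //; lia.
Qed.

Theorem theorem3p6 (n : nat) (hn : (1 <= n)%N)
    (I : {pred nat}) (hI : forall i, i \in I -> (1 <= i <= n - 1)%N)
    (k : nat) (u v : nat -> nat)
    (hIuv : forall i, i \in I <-> exists t, (1 <= t <= k)%N /\ (u t <= i <= v t)%N)
    (huv : forall t, (1 <= t <= k)%N -> (u t <= v t)%N)
    (hgap : forall t, (1 <= t)%N -> (t < k)%N -> (v t + 1 <= u (t + 1) - 1)%N)
    (A B : asmI n I) :
  (exists J : asmI n I,
      supremums [set A; B] J
      /\ supremums [set asmI_val A; asmI_val B] (asmI_val J))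
  /\ (exists C : asmI n I,
      infimums [set A; B] C
      /\ forall j, (1 <= j <= n)%N ->
           (forall i, (1 <= i <= n)%N -> i \notin I ->
              rank C i j = Num.max (rank A i j) (rank B i j))
           /\ (forall t i, (1 <= t <= k)%N -> (u t <= i <= v t)%N ->
              rank C i j = Num.min (rank C (v t + 1) j)
                                   (rank C (u t - 1) j + (i - u t + 1)%N%:Z))).
Proof.
have cm := corner_sum_max _ _ _ (rank_corner_sum n A) (rank_corner_sum n B).
split.
  have [J rJ] := asmI_join n I A B hI.
  have AJ : (asmI_val A <= asmI_val J)%O.
    by apply/asm_leP => i j hi hj; rewrite rJ //; lia.
  have BJ : (asmI_val B <= asmI_val J)%O.
    by apply/asm_leP => i j hi hj; rewrite rJ //; lia.
  (* [K] ranges over all ASMs, so both suprema follow. *)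
  have Jleast (K : asm n) : (asmI_val A <= K)%O -> (asmI_val B <= K)%O ->
      (asmI_val J <= K)%O.
    move=> /asm_leP AK /asm_leP BK; apply/asm_leP => i j hi hj; rewrite rJ //.
    by have := AK i j hi hj; have := BK i j hi hj; lia.
  exists J; split; split.
  - by move=> X [->|->].
  - by move=> K ubK; rewrite asmI_leE; apply: Jleast; apply: ubK; [left|right].
  - by move=> X [->|->].
  - by move=> K ubK; apply: Jleast; apply: ubK; [left|right].
have [C env] := asmI_meet n I A B hI.
exists C; split.
  split=> [X XAB|D lbD]; rewrite asmI_leE; apply/asm_leP => i j hi hj.
    (* The order reverses ranks: at the minimizer [h] the maximum dominates [rank X h j], and the
       Lipschitz bound carries this to row [i]. *)
    have [[h [hh _ ->]] _] := env i j hi hj.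
    have := corner_sum_lipschitz n _ h i j (rank_corner_sum n X) hh hi hj.
    by case: XAB => ->; lia.
  have /asm_leP DA : (asmI_val D <= asmI_val A)%O by apply: lbD; left.
  have /asm_leP DB : (asmI_val D <= asmI_val B)%O by apply: lbD; right.
  (* The row [h] determining [rank D i j] is also a competitor in the envelope of [C]. *)
  have [h [hh hhI ->]] := asmI_rank_base n I D i j hI hi hj.
  have [_ /(_ h hh hhI)] := env i j hi hj.
  by have := DA h j hh hj; have := DB h j hh hj; lia.
move=> j /andP[_ hj]; split=> [i /andP[_ hi] iI|t i ht hi].
  exact: (envelope_eq _ [predC I] _ _ _ _ cm env).
have inI i' : (u t <= i' <= v t)%N -> i' \in I by move=> hi'; apply/hIuv; exists t.
have ut := huv _ ht.
(* Hence [u t - 1] is not truncated and [v t + 1] is at most [n]. *)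
have := hI _ (inI (u t) _); rewrite leqnn ut => /(_ isT) hu.
have := hI _ (inI (v t) _); rewrite leqnn ut => /(_ isT) hv.
have cC := rank_corner_sum n C.
have hin : (i <= n)%N by lia.
have [h [hh hhI Ci]] := asmI_rank_base n I C i j hI hin hj.
(* The Lipschitz bounds from the two end rows give one inequality. For the other, the bound from [h]
   to the end row on its side shows that the term of that row is at most [rank C i j]. *)
have hout : (h < u t)%N || (v t < h)%N.
  by apply: contraNT hhI => hout; apply: inI; lia.
have hu' : (u t - 1 <= n)%N by lia.
have hv' : (v t + 1 <= n)%N by lia.
have := corner_sum_lipschitz _ _ _ _ _ cC hv' hin hj.
have := corner_sum_lipschitz _ _ _ _ _ cC hu' hin hj.
have := corner_sum_lipschitz _ _ _ _ _ cC hh hu' hj.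
have := corner_sum_lipschitz _ _ _ _ _ cC hh hv' hj.
lia.
Qed.
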